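(* For a family $\mathcal{G}$ of subsets of a nonempty set $X$, the following are equivalent: (i) the family $\mathcal{G}$ is isomorphic to a family of pseudoclopens in some compact connected space; (ii) for every nonempty finite $\mathcal{F}\subset\mathcal{G}$, $\mathrm{gr}(\mathcal{F})$ is a connected graph.
   Context: All compact spaces are Hausdorff and nonempty. A pseudoclopen of a compact space $K$ is a pair $a=(a^-,a^+)$ with $a^-\subset K$ closed, $a^+\subset K$ open and $a^-\subset a^+$. Let $\mathcal{G}$ be a family of subsets of a nonempty set $X$. A bijection $\phi$ from $\mathcal{G}$ onto a family of pseudoclopens of $K$ is an isomorphism if for all $n,m\ge 0$ and all distinct $a_1,\ldots,a_n,b_1,\ldots,b_m\in\mathcal{G}$: (1) if $\bigcap_{i\le n}a_i\setminus\bigcup_{j\le m}b_j=\emptyset$ then $\bigcap_{i\le n}\phi(a_i)^+\setminus\bigcup_{j\le m}\phi(b_j)^-=\emptyset$; (2) if $\bigcap_{i\le n}\phi(a_i)^-\setminus\bigcup_{j\le m}\phi(b_j)^+=\emptyset$ then $\bigcap_{i\le n}a_i\setminus\bigcup_{j\le m}b_j=\emptyset$. (Empty intersections are $X$, respectively $K$.) For a finite family $\mathcal{F}$ of subsets of $X$, the graph $\mathrm{gr}(\mathcal{F})$ has as vertices the subfamilies $\mathcal{Y}\subset\mathcal{F}$ such that $\bigcap\mathcal{Y}\setminus\bigcup(\mathcal{F}\setminus\mathcal{Y})\neq\emptyset$ (with $\bigcap\emptyset=X$), and two vertices $\mathcal{Y},\mathcal{Z}$ are joined by an edge if and only if the symmetric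 difference $\mathcal{Y}\bigtriangleup\mathcal{Z}$ has exactly one element. *)

(* Defs.v *)
From mathcomp Require Import all_boot.
From mathcomp Require Import boolp classical_sets functions cardinality.
From mathcomp Require Import topology.
From Stdlib Require Import Relation_Operators.

Set Implicit Arguments.
Unset Strict Implicit.
Unset Printing Implicit Defensive.

Local Open Scope classical_set_scope.

(** The pair [(a^-, a^+)] is represented by [(a.1, a.2)]. *)
Definition pseudoclopen (K : topologicalType) : set (set K * set K) :=
  [set a | [/\ closed a.1, open a.2 & a.1 `<=` a.2]].

(** [phi] is a total function on [set X]; only its restriction to [G]
    matters, since every condition is about members of [G]. *)
Definition pseudoclopen_isomorphism (X : Type) (K : topologicalType)
    (G : set (set X)) (H : set (set K * set K))
    (phi : set X -> set K * set K) : Prop :=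
  set_bij G H phi /\
  forall (n m : nat) (a : 'I_n -> set X) (b : 'I_m -> set X),
    (forall i, G (a i)) -> (forall j, G (b j)) ->
    injective a -> injective b -> (forall i j, a i <> b j) ->
    ((\bigcap_i a i) `\` (\bigcup_j b j) = set0 ->
     (\bigcap_i (phi (a i)).2) `\` (\bigcup_j (phi (b j)).1) = set0)
    /\
    ((\bigcap_i (phi (a i)).1) `\` (\bigcup_j (phi (b j)).2) = set0 ->
     (\bigcap_i a i) `\` (\bigcup_j b j) = set0).

Definition isomorphic_to_pseudoclopens (X : Type) (K : topologicalType)
    (G : set (set X)) : Prop :=
  exists (H : set (set K * set K)) (phi : set X -> set K * set K),
    H `<=` @pseudoclopen K /\ pseudoclopen_isomorphism G H phi.

(** Compact spaces are Hausdorff and nonempty by convention. *)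
Definition compact_space (K : topologicalType) : Prop :=
  [/\ compact [set: K], hausdorff_space K & [set: K] !=set0].

Record graph (T : Type) := Graph {
  vertices : set T;
  edge : T -> T -> Prop
}.

(** Only edges between vertices are used in a walk; the graph without vertices
    is not counted as connected. *)
Definition connected_graph (T : Type) (g : graph T) : Prop :=
  vertices g !=set0 /\
  forall y z : T, vertices g y -> vertices g z ->
    clos_refl_trans T
      (fun u v => [/\ vertices g u, vertices g v & edge g u v]) y z.

Definition gr (X : Type) (F : set (set X)) : graph (set (set X)) := {|
  vertices := [set Y | Y `<=` F /\
    (\bigcap_(A in Y) A) `\` (\bigcup_(A in F `\` Y) A) !=set0];
  edge := fun Y Z => exists A : set X, Y `+` Z = [set A]
|}.

(* Main.v *)
(** From connectedness of [K] to connectedness of [gr F]: the [A] in [F] with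
    [x] in [phi(A)^-] and those with [x] in [phi(A)^+] bound an interval of
    subfamilies all of which are vertices, and any two members of an interval
    are joined by a path. The set of points whose interval contains a given
    subfamily is open, so the connected components of [gr F] induce a partition
    of [K] into open sets, and by condition (2) each component is hit.

    Conversely, [K] is the set of the points of the cube [[0, 1]^(set X)] such
    that, for every finite [F] contained in [G], rounding each coordinate
    strictly between 0 and 1 arbitrarily to 0 or 1 always gives a vertex of
    [gr F]; take [phi(A)^- = {x_A = 1}] and [phi(A)^+ = {x_A > 0}]. For a single
    [F] this is a union of cubes spanned by vertices of [gr F], connected
    because [gr F] is, and [K] is a directed intersection of such connected
    compact sets. *)
Require Import Defs.
From mathcomp Require Import all_boot.
From mathcomp Require Import boolp classical_sets functions cardinality.
From mathcomp Require Import topology.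
From mathcomp Require Import order ssralg ssrnum interval reals filter normedtype.
From mathcomp Require Import ring lra.
From mathcomp Require Import Rstruct.
From Stdlib Require Import Relation_Operators.
From Stdlib Require Rdefinitions.

Import Order.TTheory GRing.Theory Num.Theory numFieldNormedType.Exports.

Set Implicit Arguments.
Unset Strict Implicit.
Unset Printing Implicit Defensive.

Local Open Scope ring_scope.
Local Open Scope classical_set_scope.

(** * Finite sets: eventual conditions and enumerations *)

Lemma finite_near (T I : Type) (F : set_system T) (D : set I)
    (P : I -> T -> Prop) :
  Filter F -> finite_set D -> (forall i, D i -> \forall x \near F, P i x) ->
  \forall x \near F, forall i, D i -> P i x.
Proof.
move=> FF /(@finite_seqP {classic I})[s ->] {D}.
elim: s => [|i s IHs] DP; first exact: nearW.
have /IHs sP : forall j : {classic I}, j \in s -> \forall x \near F, P j x.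
  by move=> j js; apply: DP; rewrite /= inE js orbT.
have /DP iP : [set` i :: s] i by rewrite /= inE eqxx.
apply: filterS2 sP iP => x sPx iPx j; rewrite /= inE => /orP[/eqP->//|].
exact: sPx.
Qed.

Lemma finite_set_injection (T : eqType) (A : set T) : finite_set A ->
  exists n (a : 'I_n -> T), injective a /\ range a = A.
Proof.
move=> /finite_seqP[s ->].
exists (size (undup s)), (tnth (in_tuple (undup s))); split.
  by apply/tuple_uniqP; exact: undup_uniq.
apply/seteqP; split => [_ [i _ <-]|x /= xs].
  by rewrite /= -mem_undup; exact: mem_tnth.
have /tnthP[i ->] : x \in in_tuple (undup s) by rewrite mem_undup.
by exists i.
Qed.

(** * General topology: separation, directed intersections, subspaces *)

Section topology.
Context {T : topologicalType}.
Implicit Types (A B : set T) (F : set_system T).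

(** If every [closure U] met [B], these traces would generate a filter on [B]
    and a cluster point of it would be a cluster point of [F]. *)
Lemma compact_cluster0 B F : Filter F -> compact B -> B `&` cluster F = set0 ->
  exists2 U, F U & B `&` closure U = set0.
Proof.
move=> FF cB BF; apply: contrapT => /forall2NP FB.
have PF : ProperFilter (filter_from F (fun U => B `&` closure U)).
  apply: filter_from_proper.
    apply: filter_from_filter; first by exists setT; exact: filterT.
    move=> U V FU FV; exists (U `&` V); first exact: filterI.
    move=> x [Bx UVx]; have [Ux Vx] := closureI UVx.
    by split; split.
  by move=> U FU; case: (FB U) => // /eqP/set0P.
have [|p [Bp Fp]] := cB _ PF.
  by exists setT; [exact: filterT|move=> x []].
suff : (B `&` cluster F) p by rewrite BF.
split=> // U V FU; rewrite nbhsE => -[W [oW Wp] WV].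
have [||q [[_ Uq] Wq]] := Fp (B `&` closure U) W.
- by exists U.
- exact: open_nbhs_nbhs.
have [r [Ur Wr]] := Uq _ (open_nbhs_nbhs (conj oW Wq)).
by exists r; split=> //; exact: WV.
Qed.

(** [compact_cluster0] is used twice: for the neighbourhoods of a point of [B], which in a Hausdorff
    space cluster only at that point, and then for the neighbourhoods of [A], whose cluster points
    therefore avoid [B]. *)
Lemma compact_disjoint_open A B : hausdorff_space T -> compact A -> compact B ->
  A `&` B = set0 ->
  exists U V, [/\ open U, open V, A `<=` U, B `<=` V & U `&` V = set0].
Proof.
move=> hT cA cB AB.
have sepA b : B b -> exists2 U, nbhs b U & A `&` closure U = set0.
  move=> Bb; apply: compact_cluster0 => //; apply/seteqP; split => // a [Aa].
  by move=> /hT ba; rewrite -AB; split; rewrite -?ba // ba.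
have [|U /set_nbhsP[W [oW AW WU]] BU] := @compact_cluster0 B (set_nbhs A) _ cB.
  apply/seteqP; split => // b [Bb Ab]; have [U bU AU] := sepA b Bb.
  have [|c [nUc Uc]] := Ab (~` closure U) U _ bU; last exact/nUc/subset_closure.
  move=> a Aa; apply: open_nbhs_nbhs; split.
    exact/closed_openC/closed_closure.
  by move=> Ua; rewrite -[False]/(set0 a) -AU.
exists W, (~` closure W); split => //.
- exact/closed_openC/closed_closure.
- by move=> b Bb /(closureS WU) Ub; rewrite -[False]/(set0 b) -BU.
- by apply/seteqP; split => // x [/subset_closure].
Qed.

(** A separation of the intersection extends to disjoint open sets [U] and [V]. Each [C i] must
    leave [U] or [V] uncovered somewhere, and by compactness the directed remainders have a common
    point, which the separation forbids. *)
Lemma bigcap_directed_connected (I : Type) (P : set I) (C : I -> set T) :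
  hausdorff_space T -> P !=set0 ->
  (forall i j, P i -> P j -> exists2 k, P k & C k `<=` C i `&` C j) ->
  (forall i, P i -> compact (C i)) -> (forall i, P i -> connected (C i)) ->
  connected (\bigcap_(i in P) C i).
Proof.
move=> hT [i0 Pi0] dirC cptC conC.
set K := \bigcap_(i in P) C i.
have clC i : P i -> closed (C i) by move=> /cptC; exact: compact_closed.
have cK : compact K.
  apply: (@subclosed_compact _ _ (C i0)); last exact: bigcap_inf.
    by apply: closed_bigI => i /clC.
  exact: cptC.
apply/connectedP => E [E0 KE sE].
(* [K] is closed and the closure of each piece misses the other one. *)
have clE b : closed (E b).
  move=> x Ex; have : K x.
    apply: (compact_closed hT cK); apply: closureS Ex; rewrite KE.
    by case: b => y Ey; [right|left].
  case: sE => sE1 sE2; rewrite KE => -[] Ex'; case: b Ex => // Ex.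
    by exfalso; rewrite -[False]/(set0 x) -sE2.
  by exfalso; rewrite -[False]/(set0 x) -sE1.
have cE b : compact (E b).
  by apply: subclosed_compact cK _ => // x Ex; rewrite KE; case: b Ex; [right|left].
have [U [V [oU oV EU EV UV]]] :=
  compact_disjoint_open hT (cE false) (cE true) (separated_disjoint sE).
have oUV : open (U `|` V) by exact: openU.
(* Otherwise the connected set [C i] would lie in [U] or in [V], although it contains [K], which
   meets both. *)
have CUV i : P i -> C i `\` (U `|` V) !=set0.
  move=> Pi; apply: contrapT => /nonemptyPn; rewrite setD_eq0 => CUV.
  have sUV : separated U V.
    split; apply/seteqP; split => // x [].
      by move=> Ux Vx; have [z] := Ux V (open_nbhs_nbhs (conj oV Vx)); rewrite UV.
    move=> Ux Vx; have [z] := Vx U (open_nbhs_nbhs (conj oU Ux)).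
    by rewrite setIC UV.
  have KC : K `<=` C i by exact: bigcap_inf.
  have [u Eu] := E0 false; have [v Ev] := E0 true.
  have [CU|CV] := connected_subset sUV CUV (conC _ Pi).
    suff : (U `&` V) v by rewrite UV.
    by split; [apply: CU; apply: KC; rewrite KE; right|exact: EV].
  suff : (U `&` V) u by rewrite UV.
  by split; [exact: EU|apply: CV; apply: KC; rewrite KE; left].
have PF : ProperFilter (filter_from P (fun i => C i `\` (U `|` V))).
  apply: filter_from_proper => //; apply: filter_from_filter; first by exists i0.
  move=> i j Pi Pj; have [k Pk kij] := dirC i j Pi Pj; exists k => //.
  by move=> x [/kij[? ?] ?]; split.
have [|p [_ clp]] := cptC _ Pi0 _ PF.
  by exists i0 => // x [].
have Cp i : P i -> (C i `\` (U `|` V)) p.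
  move=> Pi; have : closed (C i `\` (U `|` V)).
    by rewrite setDE; apply: closedI; [exact: clC|exact: open_closedC].
  by apply=> W /clp; apply; exists i.
have [_] := Cp _ Pi0; apply.
have : K p by move=> i /Cp[].
by rewrite KE => -[/EU|/EV]; [left|right].
Qed.

(** The image under [set_val] of a clopen set of the subspace is relatively clopen in [A]. *)
Lemma connected_set_type A : connected A -> connected [set: A].
Proof.
move=> cA B [b Bb] [_ [C oC <-] BC] [D clD BD].
suff /seteqP[_ AB] : set_val @` B = A.
  apply/seteqP; split => // x _.
  by have [y By /val_inj <-] := AB (set_val x) (set_valP x).
have clD' : exists2 D', closed D' & D = set_val @^-1` D'.
  have : open (~` D) by exact: closed_openC.
  move=> [W oW WD]; exists (~` W); first exact: open_closedC.
  by rewrite -[LHS]setCK -WD.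
have [D' cD' DE] := clD'.
apply: cA; first by exists (set_val b), b.
- exists C => //; rewrite BC setTI.
  apply/seteqP; split => [_ [x Cx <-]|x [Ax Cx]]; first by split=> //; exact: set_valP.
  by exists (SigSub (mem_set Ax)).
- exists D' => //; rewrite BD setTI DE.
  apply/seteqP; split => [_ [x Cx <-]|x [Ax Cx]]; first by split=> //; exact: set_valP.
  by exists (SigSub (mem_set Ax)).
Qed.

Lemma compact_set_type A : compact A -> compact [set: A].
Proof.
move=> cA F PF _.
have [|p [Ap Fp]] := cA (set_val @ F) _.
  by apply: (@filterS _ F _ setT) => [x _|]; [exact: set_valP|exact: filterT].
exists (SigSub (mem_set Ap)); split=> // U V FU [_ [[W oW <-] /= Wp WV]].
have [||x [Ux Wx]] := Fp (set_val @` U) W.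
- by apply: (@filterS _ F _ U) FU => x Ux; exists x.
- exact: open_nbhs_nbhs.
by case: Ux Wx => y Uy <- Wy; exists y; split => //; exact: WV.
Qed.

Lemma hausdorff_set_type A : hausdorff_space T -> hausdorff_space A.
Proof.
move=> hT p q clpq; apply: val_inj; apply: hT => U V.
rewrite nbhsE => -[U' [oU' U'p] UU]; rewrite nbhsE => -[V' [oV' V'q] VV].
have [||x [Ux Vx]] := clpq (set_val @^-1` U') (set_val @^-1` V').
- by exists (set_val @^-1` U'); split => //; exists U'.
- by exists (set_val @^-1` V'); split => //; exists V'.
by exists (set_val x); split; [exact: UU|exact: VV].
Qed.

End topology.

(** * Vertices and paths of [gr F], and isomorphisms in terms of finite sets *)

(** [Y] may have members outside [F]; only its trace on [F] counts. *)
Definition realized (X : Type) (F Y : set (set X)) : Prop :=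
  exists p, forall A, F A -> (Y A <-> A p).

Lemma gr_verticesE (X : Type) (F Y : set (set X)) :
  vertices (gr F) Y <-> Y `<=` F /\ realized F Y.
Proof.
split=> [[YF [p [Yp nYp]]]|[YF [p FYp]]]; split=> //; exists p.
  move=> A FA; split=> [/Yp//|Ap]; apply: contrapT => nYA; apply: nYp.
  by exists A.
split=> [A YA|[A [FA nYA] /= Ap]]; first exact/(FYp A (YF _ YA)).
exact/nYA/(FYp A FA).
Qed.

Definition gr_path (X : Type) (F : set (set X)) :=
  clos_refl_trans _
    (fun u v =>
      [/\ vertices (gr F) u, vertices (gr F) v & edge (gr F) u v]).

(** Members of [F] are switched one at a time, by induction on a list outside which [Y] and [Z]
    agree. The intermediate [Z'] takes its value at [A] from [Y] and the others from [Z], so it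
    stays between [L] and [U]. *)
Lemma gr_path_interval (X : Type) (F L U Y Z : set (set X)) :
  finite_set F -> U `<=` F ->
  (forall V, L `<=` V -> V `<=` U -> vertices (gr F) V) ->
  L `<=` Y -> Y `<=` U -> L `<=` Z -> Z `<=` U -> gr_path F Y Z.
Proof.
move=> /finite_seqP[s Fs] UF LU LY YU.
have YZs : Z `<=` U -> forall A, A \notin s -> Y A <-> Z A.
  move=> ZU A /negP nAs.
  by split=> [/YU/UF|/ZU/UF]; rewrite Fs /=.
move=> LZ ZU; move: (YZs ZU); elim: s Z {Fs YZs} LZ ZU => [|A s IHs] Z LZ ZU YZs.
  suff -> : Y = Z by exact: rt_refl.
  by apply/seteqP; split=> A; apply YZs.
have [YZA|nYZA] := pselect (Y A <-> Z A).
  apply: IHs => // B Bs; have [->//|/eqP BA] := pselect (B = A).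
  by apply: YZs; rewrite inE negb_or BA.
pose Z' := [set B | if B == A then Y B else Z B].
have LZ' : L `<=` Z' by move=> B LB; rewrite /Z' /=; case: eqP => _;
  [exact: LY|exact: LZ].
have ZU' : Z' `<=` U by move=> B; rewrite /Z' /=; case: eqP => _;
  [exact: YU|exact: ZU].
apply: rt_trans (IHs Z' LZ' ZU' _) _.
  move=> B Bs; rewrite /Z' /=; case: eqP => [->//|/eqP BA].
  by apply: YZs; rewrite inE negb_or BA.
apply: rt_step; split; [exact: LU|exact: LU|exists A].
apply/seteqP; split=> [B [] [] /=|_ ->].
- by rewrite /Z' /=; case: eqP.
- by rewrite /Z' /=; case: eqP.
have [YA|nYA] := pselect (Y A).
  by left; split; [rewrite /Z' /= eqxx|move=> ZA; apply: nYZA].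
right; split; last by rewrite /Z' /= eqxx.
by apply: contrapT => nZA; apply: nYZA.
Qed.

(** The conditions (1) and (2) in contraposed form, for disjoint finite subsets
    of [G] instead of injective tuples. *)
Lemma isomorphism_sets (X : Type) (K : topologicalType) (G : set (set X)) H
    (phi : set X -> set K * set K) :
  pseudoclopen_isomorphism G H phi <->
  set_bij G H phi /\
  forall Y Z, finite_set Y -> finite_set Z -> Y `<=` G -> Z `<=` G ->
    Y `&` Z = set0 ->
    ((exists x, (forall A, Y A -> (phi A).2 x) /\ (forall A, Z A -> ~ (phi A).1 x)) ->
     (exists p, (forall A, Y A -> A p) /\ (forall A, Z A -> ~ A p))) /\
    ((exists p, (forall A, Y A -> A p) /\ (forall A, Z A -> ~ A p)) ->
     (exists x, (forall A, Y A -> (phi A).1 x) /\ (forall A, Z A -> ~ (phi A).2 x))).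
Proof.
split=> -[bijphi iso]; split=> //.
  move=> Y Z /finite_set_injection[n [a [inja <-]]].
  move=> /finite_set_injection[m [b [injb <-]]] aG bG ab0.
  have [||i j aibj|iso1 iso2] := iso n m a b _ _ inja injb.
  - by move=> i; apply: aG; exists i.
  - by move=> i; apply: bG; exists i.
  - have : (range a `&` range b) (a i) by split; [exists i|exists j].
    by rewrite ab0.
  split=> [[x [ax bx]]|[p [ap bp]]]; apply: contrapT => nex.
    have /iso1 E : \bigcap_i a i `\` \bigcup_j b j = set0.
      apply/seteqP; split=> // p [ap bp]; apply: nex; exists p.
      split=> [_ [i _ <-]|_ [j _ <-] bjp]; first exact: ap.
      by apply: bp; exists j.
    rewrite -[False]/(set0 x) -E; split=> [i _|[j _]]; first by apply: ax; exists i.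
    by apply: bx; exists j.
  have /iso2 E : \bigcap_i (phi (a i)).1 `\` \bigcup_j (phi (b j)).2 = set0.
    apply/seteqP; split=> // x [ax bx]; apply: nex; exists x.
    split=> [_ [i _ <-]|_ [j _ <-] bjx]; first exact: ax.
    by apply: bx; exists j.
  rewrite -[False]/(set0 p) -E; split=> [i _|[j _]]; first by apply: ap; exists i.
  by apply: bp; exists j.
move=> n m a b aG bG inja injb ab.
have [||||| iso1 iso2] := iso (range a) (range b).
- exact: finite_image.
- exact: finite_image.
- by move=> _ [i _ <-].
- by move=> _ [i _ <-].
- by apply/seteqP; split=> // _ [[i _ <-] [j _ /esym/ab]].
split=> E; apply/seteqP; split=> // x [ax bx].
  have [|p [ap bp]] := iso1.
    exists x; split=> [_ [i _ <-]|_ [j _ <-] bjx]; first exact: ax.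
    by apply: bx; exists j.
  rewrite -[set0 x]/(set0 p) -E; split=> [i _|[j _]]; first by apply: ap; exists i.
  by apply: bp; exists j.
have [|p [ap bp]] := iso2.
  exists x; split=> [_ [i _ <-]|_ [j _ <-] bjx]; first exact: ax.
  by apply: bx; exists j.
rewrite -[set0 x]/(set0 p) -E; split=> [i _|[j _]]; first by apply: ap; exists i.
by apply: bp; exists j.
Qed.

(** * From a connected space to connected graphs *)

Lemma connected_gr_of_isomorphism (X : Type) (K : topologicalType)
    (G F : set (set X)) H (phi : set X -> set K * set K) :
  [set: X] !=set0 -> connected [set: K] -> H `<=` @pseudoclopen K ->
  pseudoclopen_isomorphism G H phi -> finite_set F -> F `<=` G ->
  connected_graph (gr F).
Proof.
move=> [p0 _] conK Hpc /isomorphism_sets[[phiH _ _] iso] finF FG.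
have pc A : F A -> pseudoclopen (phi A) by move=> /FG GA; apply/Hpc/phiH.
pose L x := [set A | F A /\ (phi A).1 x].
pose U x := [set A | F A /\ (phi A).2 x].
(* Condition (1) for [V] and its complement in [F], witnessed by [x] itself. *)
have vertexLU x V : L x `<=` V -> V `<=` U x -> vertices (gr F) V.
  move=> LV VU; apply/gr_verticesE.
  have VF : V `<=` F by move=> A /VU[].
  split=> //.
  have [||||| + _] := iso V (F `\` V).
  - exact: sub_finite_set finF.
  - by apply: sub_finite_set finF => A [].
  - by move=> A /VF/FG.
  - by move=> A [/FG].
  - by apply/seteqP; split=> // A [VA []].
  case=> [|p [Vp nVp]].
    exists x; split=> [A /VU[]//|A [FA nVA] LA].
    by apply: nVA; apply: LV.
  exists p => A FA; split=> [/Vp//|Ap].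
  by apply: contrapT => nVA; apply: (nVp A).
(* Condition (2) puts [x] in [(phi A).1] for [A] in [V] and outside [(phi A).2] for the rest of [F],
   so the interval of [x] shrinks to [V]. *)
have realize V : vertices (gr F) V -> exists x, L x = V /\ U x = V.
  move=> /gr_verticesE[VF [p FVp]].
  have [||||| _ +] := iso V (F `\` V).
  - exact: sub_finite_set finF.
  - by apply: sub_finite_set finF => A [].
  - by move=> A /VF/FG.
  - by move=> A [/FG].
  - by apply/seteqP; split=> // A [VA []].
  case=> [|x [Vx nVx]].
    exists p; split=> [A VA|A [FA nVA] Ap]; first by apply/(FVp A (VF _ VA)).
    exact/nVA/(FVp A FA).
  exists x; split; apply/seteqP; split=> A.
  - move=> [FA Ax]; apply: contrapT => nVA; apply: (nVx A) => //.
    by have [_ _] := pc A FA; apply.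
  - by move=> VA; split; [exact: VF|exact: Vx].
  - by move=> [FA Ax]; apply: contrapT => nVA; apply: (nVx A).
  - move=> VA; have FA := VF _ VA; split=> //.
    by have [_ _] := pc A FA; apply; exact: Vx.
have LU x : L x `<=` U x.
  by move=> A [FA Ax]; split=> //; have [_ _] := pc A FA; apply.
(* Near [x], [L] can only lose members and [U] only gain some, as [F] is finite, each [(phi A).1]
   closed and each [(phi A).2] open. *)
have opLU V : open [set x | L x `<=` V /\ V `<=` U x].
  rewrite openE => x [LV VU].
  have Lnear : \forall y \near x, forall A, (F `\` V) A -> ~ (phi A).1 y.
    apply: finite_near => [|A [FA nVA]]; first by apply: sub_finite_set finF => A [].
    have [cA _ _] := pc A FA; apply: open_nbhs_nbhs; split; first exact: closed_openC.
    by move=> Ax; apply: nVA; apply: LV.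
  have Unear : \forall y \near x, forall A, V A -> (phi A).2 y.
    apply: finite_near => [|A /VU[FA Ax]].
      by apply: sub_finite_set finF => A /VU[].
    by have [_ oA _] := pc A FA; apply: open_nbhs_nbhs; split.
  apply: filterS2 Lnear Unear => y Ly Uy; split=> [A [FA Ay]|A VA].
    by apply: contrapT => nVA; apply: (Ly A).
  by split; [have [] := VU _ VA|exact: Uy].
split.
  exists [set A | F A /\ A p0]; apply/gr_verticesE; split=> [A []//|].
  by exists p0 => A FA; split=> [[]|].
move=> Y Z vY vZ.
pose W := \bigcup_(V in gr_path F Y) [set x | L x `<=` V /\ V `<=` U x].
have WT : W = [set: K].
  apply: conK.
  - have [x [Lx Ux]] := realize Y vY.
    exists x; exists Y; first exact: rt_refl.
    by split; [rewrite Lx|rewrite Ux]; exact: subset_refl.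
  - by exists W; [apply: bigcup_open => V _; exact: opLU|rewrite setTI].
  - exists W; last by rewrite setTI.
    rewrite -[W]setCK; apply: open_closedC.
    (* The interval of a point is nonempty, containing [U x], and any two of its members are joined
       by a path, so it cannot meet both the component of [Y] and its complement. *)
    rewrite (_ : ~` W = \bigcup_(V in ~` gr_path F Y) [set x | L x `<=` V /\ V `<=` U x]).
      by apply: bigcup_open => V _; exact: opLU.
    apply/seteqP; split=> [x nWx|x [V nYV [LV VU]] [V' YV' [LV' VU']]].
      exists (U x); last by split=> //; exact: LU.
      by move=> YU; apply: nWx; exists (U x) => //; split=> //; exact: LU.
    apply: nYV; apply: rt_trans YV' _.
    apply: (gr_path_interval finF _ (@vertexLU x)) => //.
    by move=> A [].
have [x [Lx Ux]] := realize Z vZ.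
have : W x by rewrite WT.
move=> [V YV []]; rewrite Lx Ux => ZV VZ.
by rewrite (_ : Z = V)//; apply/seteqP.
Qed.

(** * The cubical space of a finite family: compactness and connectedness *)

Section cubical_space.
Context {R : realType} {X : Type}.
Implicit Types (F Y Z : set (set X)) (x y z : {ptws set X -> R}) (A : set X).

(** On [F], [Y] contains the [A] with [x A = 1] and avoids those with [x A = 0]. *)
Definition rounding F x : set (set (set X)) :=
  [set Y | forall A, F A -> (Y A -> 0 < x A) /\ (~ Y A -> x A < 1)].

(** Coordinates outside [F] range freely over [0, 1], so that the spaces of all [F] lie in one cube
    and can be intersected. *)
Definition cubical_space F : set {ptws set X -> R} :=
  [set x | (forall A, 0 <= x A <= 1) /\ rounding F x `<=` realized F].

Lemma eval_continuous A : continuous (fun x : {ptws set X -> R} => x A).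
Proof. exact: (@proj_continuous _ (fun=> R) A). Qed.

(** An unrealized rounding of [x] is still a rounding of all nearby points, being given by finitely
    many strict inequalities. *)
Lemma closed_rounding_realized F : finite_set F ->
  closed [set x | rounding F x `<=` realized F].
Proof.
move=> finF; rewrite -[X in closed X]setCK; apply: open_closedC.
rewrite openE => x /= /existsNP[Y /not_implyP[xY nY]].
have : \forall y \near x, rounding F y Y.
  apply: (@finite_near _ _ (nbhs x) F
    (fun A y => (Y A -> 0 < y A) /\ (~ Y A -> y A < 1))) => // A /xY[YA nYA].
  have [AY|AnY] := pselect (Y A).
    have : \forall y \near x, 0 < y A.
      apply: (@eval_continuous A x [set r | 0 < r]).
      by apply: open_nbhs_nbhs; split; [exact: open_gt|exact: YA].
    by apply: filterS.
  have : \forall y \near x, y A < 1.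
    apply: (@eval_continuous A x [set r | r < 1]).
    by apply: open_nbhs_nbhs; split; [exact: open_lt|exact: nYA].
  by apply: filterS.
apply: filterS => y yY yF; exact/nY/yF.
Qed.

Lemma ptws_hausdorff : hausdorff_space {ptws set X -> R}.
Proof.
apply: (@hausdorff_product (set X) (fun=> R)) => _.
exact: norm_hausdorff.
Qed.

Lemma cubical_space_compact F : finite_set F -> compact (cubical_space F).
Proof.
move=> finF; pose C : set {ptws set X -> R} :=
    [set x | forall A, 0 <= x A <= 1].
have cC : compact C.
  apply: (@tychonoff (set X) (fun=> R) (fun=> [set r | 0 <= r <= 1])) => _.
  by rewrite -set_itvcc; exact: segment_compact.
apply: (@subclosed_compact _ _ C) => //; last by move=> x [].
apply: (@closedI _ C); last exact: closed_rounding_realized.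
exact: compact_closed ptws_hausdorff cC.
Qed.

Lemma cubical_space_mono F F' : F `<=` F' ->
  cubical_space F' `<=` cubical_space F.
Proof.
move=> FF' x [x01 xF']; split=> // Y xY.
(* A rounding on [F] extends to [F'] by rounding every positive coordinate outside [F] up. *)
have [|p pP] := xF' [set A | (F A /\ Y A) \/ (~ F A /\ 0 < x A)].
  move=> A F'A; split=> [[[/xY[+ _] YA]|[]//]|/= nA]; first exact.
  have [FA|nFA] := pselect (F A).
    by apply: (xY A FA).2 => YA; apply: nA; left.
  have /negP : ~ 0 < x A by move=> ?; apply: nA; right.
  by rewrite -leNgt => /le_lt_trans; apply.
exists p => A FA; rewrite -(pP A (FF' _ FA)).
by split=> [YA|[[]|[]]//]; left.
Qed.

Definition convex_path x y (t : R) : {ptws set X -> R} :=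
  fun A => (1 - t) * x A + t * y A.

Lemma convex_path_continuous x y : continuous (convex_path x y).
Proof.
move=> t; apply/cvg_sup => A U [_ [[V oV <-] /= Vt VU]].
have cA : continuous (fun s : R => (1 - s) * x A + s * y A).
  move=> s; apply: cvgD; apply: cvgM => //; try exact: cvg_cst.
  by apply: cvgB => //; exact: cvg_cst.
have tV := cA t V (open_nbhs_nbhs (conj oV Vt)).
by apply: (@filterS _ (nbhs t) _ [set s | V (convex_path x y s A)]) => // s /VU.
Qed.

(** The hypothesis keeps the whole segment inside the space: its points have only roundings that an
    endpoint has, hence realized ones. *)
Lemma convex_path_connected_component F x y :
  cubical_space F x -> cubical_space F y ->
  (forall t Y, 0 <= t <= 1 -> rounding F (convex_path x y t) Y ->
    rounding F x Y \/ rounding F y Y) ->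
  connected_component (cubical_space F) x y.
Proof.
move=> Fx Fy xyY; exists (convex_path x y @` `[0, 1]); last first.
  exists 1; first by rewrite /= in_itv /= ler01 lexx.
  by apply/funext => A; rewrite /convex_path subrr mul0r add0r mul1r.
split.
- exists 0; first by rewrite /= in_itv /= ler01 lexx.
  by apply/funext => A; rewrite /convex_path subr0 mul0r addr0 mul1r.
- move=> _ [t /= t01 <-]; split=> [A|Y /(xyY _ _ t01)[]]; [|exact: Fx.2|exact: Fy.2].
  move: t01 (Fx.1 A) (Fy.1 A); rewrite !in_itv/= /convex_path.
  by move=> /andP[? ?] /andP[? ?] /andP[? ?]; apply/andP; split; nra.
- apply: connected_continuous_connected; first exact: segment_connected.
  exact/continuous_subspaceT/convex_path_continuous.
Qed.

Definition corner Y : {ptws set X -> R} := fun A => (`[< Y A >])%:R.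

(** Coordinates equal to 0 or 1 leave no choice. *)
Lemma corner_rounding F Y Z : rounding F (corner Y) Z <->
  (forall A, F A -> (Z A <-> Y A)).
Proof.
split=> FYZ A FA; move: (FYZ A FA); rewrite /corner; case: asboolP => YA.
- by rewrite ltr01 ltxx => -[_ nZ]; split=> // _; apply: contrapT => /nZ.
- by rewrite ltr01 ltxx => -[Z0 _]; split=> // /Z0.
- by move=> ZY; rewrite ltr01 ltxx; split=> // nZ; exfalso; apply/nZ/ZY.
- by move=> ZY; rewrite ltr01 ltxx; split=> // /ZY.
Qed.

Lemma corner_cubical_space F Y : realized F Y -> cubical_space F (corner Y).
Proof.
move=> [p pP]; split=> [A|Z /corner_rounding YZ].
  by rewrite /corner ler0n lern1; case: asboolP.
by exists p => A FA; rewrite YZ // pP.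
Qed.

(** The corner rounds all positive coordinates in [F] up. On the segment towards it, coordinates in
    [F] that are 0 or 1 at [x] do not move, and the others may be rounded both ways at [x], so no
    new rounding appears. *)
Lemma cubical_space_corner F x : cubical_space F x ->
  exists2 Y, vertices (gr F) Y &
    connected_component (cubical_space F) x (corner Y).
Proof.
move=> Fx; pose Y := [set A | F A /\ 0 < x A].
have rY : realized F Y.
  apply: Fx.2 => A FA; split=> [[]//|nY].
  have /negP : ~ 0 < x A by move=> ?; apply: nY.
  by rewrite -leNgt => /le_lt_trans; apply.
exists Y; first by apply/gr_verticesE; split=> // A [].
apply: convex_path_connected_component => //; first exact: corner_cubical_space.
move=> t Z /andP[t0 t1] Zt; left => A FA.
have := Zt A FA; have /andP[x0 x1] := Fx.1 A.
rewrite /convex_path /corner; case: asboolP => [[_ x_gt0]|nYA] [Zpos nZ1].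
  split=> // /nZ1; rewrite mulr1; case: (ltP (x A) 1) => // x1'.
  have -> : x A = 1 by apply/eqP; rewrite eq_le x1.
  by rewrite mulr1 subrK ltxx.
have xA0 : x A = 0.
  by apply/eqP; rewrite eq_le x0 andbT leNgt; apply/negP => ?; apply: nYA.
by rewrite xA0 ltr01; split=> // /Zpos; rewrite xA0 !mulr0 addr0 ltxx.
Qed.

(** Along an edge only the coordinate [A] varies, so a rounding of a point of the segment agrees on
    [F] with one of the two ends. *)
Lemma gr_path_corner F Y Z : gr_path F Y Z -> vertices (gr F) Y ->
  connected_component (cubical_space F) (corner Y) (corner Z).
Proof.
elim=> {Y Z} [Y Z [/gr_verticesE[_ rY] /gr_verticesE[_ rZ] [A YZ]] _|Y|].
- apply: convex_path_connected_component; [exact: corner_cubical_space..|].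
  move=> t V t01 tV.
  have BA B : F B -> B <> A -> (V B <-> Y B) /\ (V B <-> Z B).
    move=> FB BA.
    have YZB : Y B <-> Z B.
      have nB : ~ (Y `+` Z) B by rewrite YZ.
      by split=> ?; apply: contrapT => ?; apply: nB; [left|right].
    suff VZB : V B <-> Z B by split=> //; rewrite YZB.
    have := tV B FB.
    rewrite /convex_path /corner (asbool_equiv_eq YZB) -mulrDl subrK mul1r.
    case: asboolP => ZB; rewrite ltr01 ltxx => -[V0 V1]; split=> //.
      by move=> _; apply: contrapT => /V1.
    by move=> /V0.
  have YZA : (Y `+` Z) A by rewrite YZ.
  have [VYA|nVYA] := pselect (V A <-> Y A); [left|right].
    apply/corner_rounding => B FB.
    by have [->//|nBA] := pselect (B = A); exact: (BA B FB nBA).1.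
  apply/corner_rounding => B FB.
  have [->|nBA] := pselect (B = A); last exact: (BA B FB nBA).2.
  have [VA|nVA] := pselect (V A).
    split=> // _; case: YZA => -[] // YA _; exfalso; exact: nVYA.
  split=> // ZA; case: YZA => -[] // _ nYA; exfalso; exact: nVYA.
- by move=> /gr_verticesE[_ rY]; apply/connected_component_refl/corner_cubical_space.
- move=> Y Z V YZ IHYZ ZV IHZV vY.
  apply: (connected_component_trans (IHYZ vY)); apply: IHZV.
  (* The end of a path starting at a vertex is a vertex. *)
  by elim: YZ vY => // [? ? []//|? ? ? _ IH1 _ IH2 /IH1/IH2].
Qed.

Lemma cubical_space_connected F : connected_graph (gr F) ->
  connected (cubical_space F).
Proof.
move=> [[Y0 vY0] conF].
have F0 : cubical_space F (corner Y0).
  by apply: corner_cubical_space; move: vY0 => /gr_verticesE[].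
rewrite (_ : cubical_space F = connected_component (cubical_space F) (corner Y0)).
  exact: component_connected.
apply/seteqP; split; last exact: connected_component_sub.
move=> x Fx; have [Y vY xY] := cubical_space_corner Fx.
apply: connected_component_trans (connected_component_sym xY).
exact: (gr_path_corner (conF _ _ vY0 vY) vY0).
Qed.

End cubical_space.

(** * From connected graphs to a connected compact space *)

Lemma set_type_continuous (T : topologicalType) (A : set T) :
  continuous (set_val : A -> T).
Proof. exact: initial_continuous. Qed.

Lemma isomorphic_to_pseudoclopens_of_connected_gr (R : realType) (X : Type)
    (G : set (set X)) :
  [set: X] !=set0 ->
  (forall F, finite_set F -> F `<=` G -> connected_graph (gr F)) ->
  exists K : topologicalType,
    [/\ compact_space K, connected [set: K] & isomorphic_to_pseudoclopens K G].
Proof.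
move=> [p0 _] conG.
pose P := [set F : set (set X) | finite_set F /\ F `<=` G].
pose K0 := \bigcap_(F in P) @cubical_space R X F.
have P0 : P !=set0 by exists set0; split=> // A.
have cK0 : compact K0.
  (* [set0] belongs to [P], so its space is a compact set containing [K0]. *)
  apply: (@subclosed_compact _ _ (@cubical_space R X set0)).
  - apply: closed_bigI => F [finF _]; apply: compact_closed; first exact: ptws_hausdorff.
    exact: cubical_space_compact.
  - exact: cubical_space_compact.
  - by apply: bigcap_inf; split=> // A.
have conK0 : connected K0.
  apply: bigcap_directed_connected => //.
  - exact: ptws_hausdorff.
  - move=> F F' [finF FG] [finF' FG']; exists (F `|` F').
      by split; [rewrite finite_setU|rewrite subUset].
    by move=> x Fx; split; apply: cubical_space_mono Fx => A ?; [left|right].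
  - by move=> F [finF _]; exact: cubical_space_compact.
  - by move=> F [finF FG]; apply: cubical_space_connected; exact: conG.
(* Each point of [X] gives a corner in [K0]. These corners show that [K0] is nonempty, that [phi] is
   injective on [G], and that condition (2) holds. *)
have K0_eval p : K0 (corner [set A | A p]).
  by move=> F _; apply: corner_cubical_space; exists p.
pose ev p : K0 := SigSub (mem_set (K0_eval p)).
have ev1 p A : A p -> set_val (ev p) A = 1.
  by move=> Ap; rewrite -[LHS]/((`[< A p >])%:R : R) asboolT.
have ev0 p A : ~ A p -> set_val (ev p) A = 0.
  by move=> Ap; rewrite -[LHS]/((`[< A p >])%:R : R) asboolF.
pose phi A := ([set x : K0 | set_val x A = 1], [set x : K0 | 0 < set_val x A]).
have phiC A : continuous (fun x : K0 => set_val x A).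
  move=> x; apply: (@continuous_comp _ _ _ (set_val : K0 -> _) (fun y => y A)).
    exact: set_type_continuous.
  exact: eval_continuous.
exists K0; split.
- split; [exact: compact_set_type|exact/hausdorff_set_type/ptws_hausdorff|].
  by exists (ev p0).
- exact: connected_set_type.
exists (phi @` G), phi; split.
  move=> _ [A GA <-]; split.
  - by have /continuous_closedP := @phiC A => /(_ [set r | r = 1]); apply; exact: closed_eq.
  - by have /continuousP := @phiC A => /(_ [set r | 0 < r]); apply; exact: open_gt.
  - by move=> x /= ->; exact: ltr01.
apply/isomorphism_sets; split.
  split=> [A GA|A B /set_mem GA /set_mem GB AB|_ [A GA <-]]; first by exists A.
  - have AB1 : (phi A).1 = (phi B).1 by rewrite AB.
    have inclAB C D p : (phi C).1 = (phi D).1 -> C p -> D p.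
      move=> CD Cp; apply: contrapT => /ev0 D0.
      have : (phi D).1 (ev p) by rewrite -CD; exact: ev1.
      by rewrite /phi /= D0 => /eqP; rewrite eq_sym oner_eq0.
    by apply/seteqP; split=> p; exact: inclAB.
  - by exists A.
move=> Y Z finY finZ YG ZG YZ0; split=> [[x [Yx Zx]]|[p [Yp Zp]]].
  have [|x01 xr] := set_valP x (Y `|` Z).
    by split; [rewrite finite_setU|rewrite subUset].
  (* [Y] is a rounding of [x] on the union of [Y] and [Z]: coordinates are positive on [Y] and below
     1 on [Z]. *)
  have [|p pY] := xr Y.
    move=> A YZA; split=> [/Yx//|nYA].
    have ZA : Z A by case: YZA.
    have /andP[_ xA1] := x01 A; rewrite lt_neqAle xA1 andbT.
    by apply/eqP => /(Zx A ZA).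
  exists p; split=> [A YA|A ZA Ap]; first by apply/(pY A) => //; left.
  suff : (Y `&` Z) A by rewrite YZ0.
  by split=> //; apply/(pY A) => //; right.
exists (ev p); split=> [A /Yp|A /Zp nAp]; first exact: ev1.
by rewrite /phi /= (ev0 _ _ nAp) ltxx.
Qed.

(** Bridges the gap between nonempty finite families and all finite families: here [set0] is the
    only vertex. *)
Lemma connected_gr_set0 (X : Type) : [set: X] !=set0 ->
  connected_graph (gr (set0 : set (set X))).
Proof.
move=> [p0 _]; split.
  by exists set0; split=> //; exists p0; split=> [A []|[A []] []].
by move=> Y Z [+ _] [+ _] /=; rewrite !subset0 => -> ->; exact: rt_refl.
Qed.

Theorem theorem3p2 (X : Type) (hX : [set: X] !=set0) (G : set (set X)) :
  (exists K : topologicalType,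
     [/\ compact_space K, connected [set: K]
       & isomorphic_to_pseudoclopens K G])
  <->
  (forall F : set (set X),
     F !=set0 -> finite_set F -> F `<=` G -> connected_graph (gr F)).
Proof.
split=> [[K [_ conK [H [phi [HK iso]]]]] F _ finF FG|conG].
  exact: connected_gr_of_isomorphism hX conK HK iso finF FG.
(* Any model of the reals would serve for the cube. *)
apply: (@isomorphic_to_pseudoclopens_of_connected_gr Rdefinitions.R) => // F finF FG.
have [->|/set0P F0] := eqVneq F set0; first exact: connected_gr_set0.
exact: conG.
Qed.
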